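(* Every specialization poset $\mathbf P$ can be embedded into a topological specialization poset in such a way that the embedding preserves all existing (possibly infinitary) meets in $\mathbf P$. That is, for every specialization poset $\mathbf P = (P, \leq, \sqsubseteq)$ there are a topological space $X$ and an embedding of specialization posets $\iota : \mathbf P \to (\mathcal P(X), \subseteq, \sqsubseteq)$ such that whenever a family of elements of $P$ has a meet (with respect to $\leq$) in $\mathbf P$, $\iota$ sends this meet to the meet of the images in $(\mathcal P(X), \subseteq)$.
   Context: A specialization poset is a structure $(S, \leq, \sqsubseteq)$ such that $(S, \leq)$ is a partially ordered set and $\sqsubseteq$ is a binary relation on $S$ satisfying, for all $a,b,c \in S$: (S1) $a \leq b$ implies $a \sqsubseteq b$; (S2) $a \sqsubseteq b$ and $b \sqsubseteq c$ imply $a \sqsubseteq c$. For a topological space $X$ with topological closure $K$, $\mathbf P(X) = (\mathcal P(X), \subseteq, \sqsubseteq)$ where $a \sqsubseteq b$ means $a \subseteq Kb$. A specialization poset is topological if it is isomorphic to $\mathbf P(X)$ for some topological space $X$. An embedding of specialization posets is a function $\psi$ such that, for all $a, b$, $a \leq b$ if and only if $\psi(a) \leq \psi(b)$, and $a \sqsubseteq b$ if and only if $\psi(a) \sqsubseteq \psi(b)$. *)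

(* Defs.v *)
From HB Require Import structures.
From mathcomp Require Import all_boot all_order.
From mathcomp Require Import boolp classical_sets topology.

Set Implicit Arguments.
Unset Strict Implicit.
Unset Printing Implicit Defensive.

Import Order.TTheory.

Local Open Scope classical_set_scope.
Local Open Scope order_scope.

HB.mixin Record POrder_isSpecialization (d : Order.disp_t) T
    of Order.POrder d T := {
  spec : T -> T -> Prop;
  le_spec : forall a b : T, a <= b -> spec a b;
  spec_trans : forall a b c : T, spec a b -> spec b c -> spec a c
}.

#[short(type="specPosetType")]
HB.structure Definition SpecPoset (d : Order.disp_t) :=
  {T of POrder_isSpecialization d T & Order.POrder d T}.

Reserved Notation "a [<= b" (at level 70, no associativity).
Notation "a [<= b" := (spec a b) : order_scope.

(* The specialization poset P(X): the order of [set X] is inclusion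
   ([subsetEset]), and a [<= b means that a is included in the closure of b. *)
Section PowersetSpecPoset.
Context (X : topologicalType).

Definition set_spec (a b : set X) : Prop := a `<=` closure b.

Lemma set_le_spec (a b : set X) : a <= b -> set_spec a b.
Proof. by rewrite subsetEset => /subset_trans; apply; exact: subset_closure. Qed.

Lemma set_spec_trans (a b c : set X) :
  set_spec a b -> set_spec b c -> set_spec a c.
Proof.
move=> ab /closureS bc; apply: (subset_trans ab); apply: (subset_trans bc).
by rewrite -(closure_id _).1//; exact: closed_closure.
Qed.

HB.instance Definition _ := POrder_isSpecialization.Build set_display (set X)
  set_le_spec set_spec_trans.

End PowersetSpecPoset.

Definition spec_embedding (d d' : Order.disp_t)
    (P : specPosetType d) (Q : specPosetType d') (f : P -> Q) : Prop :=
  (forall a b : P, a <= b <-> f a <= f b) /\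
  (forall a b : P, a [<= b <-> f a [<= f b).

(* [infimums F m] says that m is a meet of F. Here F may be empty, in which
   case m is the greatest element. *)
Definition preserves_meets (d d' : Order.disp_t)
    (P : porderType d) (Q : porderType d') (f : P -> Q) : Prop :=
  forall (F : set P) (m : P), infimums F m -> infimums (f @` F) (f m).

(* Main.v *)
From HB Require Import structures.
Require Import Defs.
From mathcomp Require Import all_boot all_order.
From mathcomp Require Import boolp classical_sets topology.

(** The relation [spec] is a preorder, since it contains the reflexive order of
    [P], so it is the specialization preorder of an Alexandrov topology on the
    points of [P]: a set is open when it is closed upwards along [spec], and the
    closure of a set consists of the points [spec]-below one of its elements.
    The space [X] is [P] with this topology, and [a] is sent to its principal
    ideal [{x | x <= a}].

    Principal ideals embed any poset into its powerset, and turn a meet into an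
    intersection because [x <= m] holds exactly when [x] is a lower bound of
    the family.  By transitivity of [spec], a point [spec]-below an element of
    the ideal of [b] is [spec]-below [b], which itself lies in the ideal; so the
    closure of this ideal is [{x | spec x b}].  It contains the ideal of [a]
    exactly when [spec a b]. *)

Set Implicit Arguments.
Unset Strict Implicit.
Unset Printing Implicit Defensive.

Import Order.TTheory.

Local Open Scope classical_set_scope.
Local Open Scope order_scope.

Lemma spec_refl (d : Order.disp_t) (P : specPosetType d) (a : P) : a [<= a.
Proof. exact: le_spec. Qed.

(** A separate name for the carrier of [P], so that the topology does not
    compete with one that the carrier may already have. *)
Definition alexandrov (d : Order.disp_t) (P : specPosetType d) : Type := P.

HB.instance Definition _ (d : Order.disp_t) (P : specPosetType d) :=
  Choice.on (alexandrov P).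

Section AlexandrovTopology.
Context (d : Order.disp_t) (P : specPosetType d).

Definition spec_open (U : set (alexandrov P)) : Prop :=
  forall x y : P, U x -> x [<= y -> U y.

Lemma spec_openT : spec_open setT. Proof. by []. Qed.

Lemma spec_openI (U V : set (alexandrov P)) :
  spec_open U -> spec_open V -> spec_open (U `&` V).
Proof. by move=> oU oV x y [Ux Vx] xy; split; [exact: oU xy|exact: oV xy]. Qed.

Lemma spec_open_bigU (I : Type) (U : I -> set (alexandrov P)) :
  (forall i, spec_open (U i)) -> spec_open (\bigcup_i U i).
Proof. by move=> oU x y [i _ Ux] xy; exists i => //; exact: oU xy. Qed.

HB.instance Definition _ := isOpenTopological.Build (alexandrov P)
  spec_openT spec_openI spec_open_bigU.

(** The set of points above [x] is the least neighbourhood of [x], so it alone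
    decides whether [x] is in a closure. *)
Lemma closure_alexandrov (A : set (alexandrov P)) (x : P) :
  closure A x <-> exists2 y : P, A y & x [<= y.
Proof.
split=> [clAx|[y Ay xy] B].
  have /clAx [y [Ay xy]] : nbhs (x : alexandrov P) [set y : P | x [<= y].
    apply: open_nbhs_nbhs; split; last exact: spec_refl.
    by move=> y z /= xy yz; exact: spec_trans xy yz.
  by exists y.
rewrite nbhsE => -[U [oU Ux] UB].
by exists y; split=> //; apply: UB; exact: (oU : spec_open U) Ux xy.
Qed.

Definition principal_ideal (a : P) : set (alexandrov P) := [set x : P | x <= a].

Lemma closure_principal_ideal (a : P) :
  closure (principal_ideal a) = [set x : P | x [<= a].
Proof.
apply/seteqP; split=> x /=.
  by move=> /closure_alexandrov[y /le_spec ya xy]; exact: spec_trans xy ya.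
by move=> xa; apply/closure_alexandrov; exists a => //; exact: lexx.
Qed.

Lemma principal_ideal_embedding : spec_embedding principal_ideal.
Proof.
split=> a b.
  rewrite subsetEset; split=> [ab x xa|]; first exact: le_trans xa ab.
  by apply; exact: lexx.
rewrite /spec /= /set_spec closure_principal_ideal.
split=> [ab x /le_spec xa|]; first exact: spec_trans xa ab.
by apply; exact: lexx.
Qed.

Lemma principal_ideal_preserves_meets : preserves_meets principal_ideal.
Proof.
move=> F m [mF m_max]; split=> [_ [a Fa <-]|A AF].
  by apply/(principal_ideal_embedding.1 m a); exact: mF.
rewrite subsetEset => x Ax; apply: m_max => a Fa.
have /AF : (principal_ideal @` F) (principal_ideal a) by exists a.
by rewrite subsetEset; exact.
Qed.

End AlexandrovTopology.

Theorem proposition5p10 (d : Order.disp_t) (P : specPosetType d) :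
  exists (X : topologicalType) (iota : P -> set X),
    spec_embedding iota /\ preserves_meets iota.
Proof.
exists (alexandrov P), (@principal_ideal d P).
by split; [exact: principal_ideal_embedding|exact: principal_ideal_preserves_meets].
Qed.
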